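(* Let $d_i>0$, $p_i\in[0,1]$, and let $g_i(t)\le t$ be the time-stamp of the last packet of user $i$ successfully received by the monitor by time $t$. With $A_i(u)=X_i(u)-\hat X_i(u)$ for $g_i(t)\le u\le t$, the mean of the AoII at slot $t$, denoted $n_i(t)$, equals $$n_i(t)=\sum_{u=g_i(t)}^{t} d_i\,\mathbb{E}[A_i(u)]=d_i\,p_i\,\frac{(t-g_i(t)+1)(t-g_i(t))}{2}.$$
   Context: Time is discrete. The source process $X_i$ of user $i$ is a Markov chain on the integers which, at each time slot, independently of the past, moves to the next state ($X_i(u+1)=X_i(u)+1$) with probability $p_i$ and stays in the same state ($X_i(u+1)=X_i(u)$) with probability $1-p_i$. The distance between two consecutive states is $d_i$. The monitor's estimate is $\hat X_i(u)=X_i(g_i(t))$ for $g_i(t)\le u\le t$, i.e. the state contained in the last successfully received packet. From the monitor's viewpoint $g_i(t)$ and $X_i(g_i(t))$ are known (fixed), and the expectation is over the evolution of $X_i$ after time $g_i(t)$. The (distance-based) Age of Incorrect Information (AoII) at time $t$ is $\sum_{u=g_i(t)}^{t} d_i\,[X_i(u)-\hat X_i(t)]$. *)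

(* Defs.v *)
From HB Require Import structures.
From mathcomp Require Import all_boot all_order all_algebra.
From mathcomp Require Import all_classical all_reals all_analysis.

Set Implicit Arguments.
Unset Strict Implicit.
Unset Printing Implicit Defensive.

Import Order.TTheory GRing.Theory Num.Theory.
Local Open Scope classical_set_scope.
Local Open Scope ring_scope.

(* Conditioning on an event B; only meaningful when 0 < P B. *)
Definition cond_pr (d : measure_display) (T : measurableType d) (R : realType)
    (P : probability T R) (B A : set T) : R :=
  fine (P (A `&` B)) / fine (P B).

Definition cond_expectation (d : measure_display) (T : measurableType d)
    (R : realType) (P : probability T R) (B : set T) (Y : T -> R) : \bar R :=
  ((fine (P B))^-1%:E * 'E_P[fun w => (Y w * \1_B w)%R])%E.

(* Time-homogeneous Markov chain on the integers with transition matrix K and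
   arbitrary initial law. There is no canonical measurable structure on int;
   as int is countable, measurability of X u for the discrete sigma-algebra
   amounts to that of the preimages of singletons. *)
Definition markov_chain (d : measure_display) (T : measurableType d)
    (R : realType) (P : probability T R) (K : int -> int -> R)
    (X : nat -> T -> int) : Prop :=
  (forall (u : nat) (x : int), measurable (X u @^-1` [set x])) /\
  (forall (u : nat) (h : nat -> int) (y : int),
     let past := [set w | forall k : nat, (k <= u)%N -> X k w = h k] in
     (0 < P past)%E ->
     cond_pr P past (X u.+1 @^-1` [set y]) = K (h u) y).

Definition source_kernel (R : realType) (p : R) (x y : int) : R :=
  if y == x + 1 then p else if y == x then 1 - p else 0.

Definition est_error (T : Type) (R : realType) (X Xhat : nat -> T -> int)
    (u : nat) (w : T) : R :=
  (X u w - Xhat u w)%:~R.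

(* The estimate subtracted here is the one at time t, not at time u. *)
Definition aoii (T : Type) (R : realType) (dist : R)
    (X Xhat : nat -> T -> int) (g : nat -> nat) (t : nat) (w : T) : R :=
  \sum_(g t <= u < t.+1) dist * (X u w - Xhat t w)%:~R.

(* The monitor knows g t and the state x = X (g t): the mean is conditional on
   the event that X is in state x at time g t. *)
Definition mean_aoii (d : measure_display) (T : measurableType d)
    (R : realType) (P : probability T R) (dist : R)
    (X Xhat : nat -> T -> int) (g : nat -> nat) (x : int) (t : nat) : \bar R :=
  cond_expectation P (X (g t) @^-1` [set x]) (aoii dist X Xhat g t).

(* Main.v *)
(* Splitting X m = x into the countably many full histories up to time u, the
   Markov property shows that, given X m = x, the increment X (u+1) - X u is 1
   with probability p and 0 with probability 1 - p. Hence it has conditional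
   mean p, so X u - X m has conditional mean (u - m) p, and
   0 + 1 + ... + (t - g t) gives the triangular number. *)
Require Import Defs.
From HB Require Import structures.
From mathcomp Require Import all_boot all_order all_algebra.
From mathcomp Require Import all_classical all_reals all_analysis.
From mathcomp Require Import measurable_realfun ring.

Set Implicit Arguments.
Unset Strict Implicit.
Unset Printing Implicit Defensive.

Import Order.TTheory GRing.Theory Num.Theory.
Local Open Scope classical_set_scope.
Local Open Scope ring_scope.

(** Since [int] is countable, the preimage of any set of reals is a countable union of fibres of
    [Z]. *)
Lemma measurable_fun_int (d : measure_display) (T : measurableType d)
    (R : realType) (Z : T -> int) :
  (forall z, measurable (Z @^-1` [set z])) ->
  measurable_fun setT (fun w => (Z w)%:~R : R).
Proof.
move=> mZ _ Y _; rewrite setTI.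
rewrite (_ : _ @^-1` Y =
    \bigcup_z (if z%:~R \in Y then Z @^-1` [set z] else set0)).
  apply: countable_bigcupT_measurable => [|z]; first exact: countableP.
  by case: ifP.
apply/seteqP; split=> w /=.
  by move=> YZ; exists (Z w) => //; rewrite mem_set.
by case=> z _; case: ifP => // /set_mem Yz /= ->.
Qed.

(** This reads the mean of a 0/1-valued step off as a probability. Measurability of [f] is assumed
    separately because [P] need not be complete. *)
Lemma ae_eq_indic_integral (d : measure_display) (T : measurableType d)
    (R : realType) (P : probability T R) (f : T -> R) (S : set T) :
  measurable_fun setT f -> measurable S ->
  ae_eq P setT (EFin \o f) (EFin \o \1_S) ->
  P.-integrable setT (EFin \o f) /\ (\int[P]_w (f w)%:E = P S)%E.
Proof.
move=> mf mS fS.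
have /measurable_EFinP mfE := mf.
have iS := integrable_indic P mS.
have /measurable_EFinP mSE := @measurable_indic _ T R setT S mS.
split; last first.
  by rewrite (ae_eq_integral (EFin \o \1_S)) // integral_indic // setIT.
apply/integrableP; split=> //.
rewrite (ae_eq_integral (abse \o (EFin \o \1_S))) //.
- by case/integrableP: iS.
- exact: measurableT_comp.
- exact: measurableT_comp.
- exact: ae_eq_comp.
Qed.

Section markov_chain_increments.
Context (d : measure_display) (T : measurableType d) (R : realType)
        (P : probability T R) (X : nat -> T -> int).
Context (mX : forall u x, measurable (X u @^-1` [set x])).

Let measurable_X u : measurable_fun setT (fun w => (X u w)%:~R : R).
Proof. exact: measurable_fun_int. Qed.

Let measurable_diff u v :
  measurable_fun setT (fun w => (X u w - X v w)%:~R : R).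
Proof.
under eq_fun do rewrite intrB.
exact: (measurable_funB (measurable_X u) (measurable_X v)).
Qed.

Let measurable_step u j : measurable [set w | X u.+1 w = X u w + j].
Proof.
rewrite (_ : mkset _ =
  setT `&` (fun w => (X u.+1 w - X u w)%:~R : R) @^-1` [set j%:~R]).
  exact: measurable_diff.
rewrite setTI; apply/seteqP; split=> w /=.
  by move=> ->; rewrite addrAC subrr add0r.
by move=> /intr_inj <-; rewrite addrC subrK.
Qed.

Let measurable_past u (h : nat -> int) :
  measurable [set w | forall k, (k <= u)%N -> X k w = h k].
Proof.
rewrite (_ : mkset _ =
    \bigcap_(k in [set k | (k <= u)%N]) X k @^-1` [set h k]) //.
by apply: bigcap_measurable => //; exists 0%N.
Qed.

(* The countably many histories up to time u partition T, and each of them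
   is either contained in or disjoint from the event X m = x. *)
Lemma markov_chain_step (K : int -> int -> R) (q : R) (j : int)
    (m u : nat) (x : int) :
  markov_chain P K X -> (m <= u)%N -> (forall z, K z (z + j) = q) -> 0 <= q ->
  P (X m @^-1` [set x] `&` [set w | X u.+1 w = X u w + j]) =
  (q%:E * P (X m @^-1` [set x]))%E.
Proof.
move=> [_ HK] mu Kq q0.
set B := X m @^-1` [set x]; set E := [set w | _].
have mB : measurable B := mX m x.
have mE : measurable E := measurable_step u j.
(* Coding the finite sequence [X 0 w, ..., X u w] by a natural number indexes the histories by
   [nat], so that sigma-additivity applies. A number that codes no realised history gives an empty
   class. *)
pose hist w := pickle [seq X k w | k <- iota 0 u.+1].
pose F n := hist @^-1` [set n].
have histP w w' : hist w = hist w' <-> forall k, (k <= u)%N -> X k w = X k w'.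
  rewrite /hist; split=> [/(pcan_inj pickleK)/eq_in_map eqw k ku|eqw].
    by apply: eqw; rewrite mem_iota.
  by congr pickle; apply/eq_in_map => k; rewrite mem_iota => /eqw.
have FE w : F (hist w) = [set w' | forall k, (k <= u)%N -> X k w' = X k w].
  by apply/seteqP; split=> w' /histP.
have F0 n : F n = set0 \/ exists w, n = hist w.
  have [->|/set0P[w Fw]] := eqVneq (F n) set0; first by left.
  by right; exists w.
have mF n : measurable (F n).
  by case: (F0 n) => [->//|[w ->]]; rewrite FE; exact: measurable_past.
have PF A : measurable A -> P A = (\sum_(n <oo) P (A `&` F n))%E.
  move=> mA; rewrite -measure_semi_bigcup.
  - rewrite -setI_bigcupr; congr (P _).
    by apply/seteqP; split=> [w Aw|w []//]; split=> //; exists (hist w).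
  - by move=> n; exact: measurableI.
  - by apply: trivIset_setIl; exact: trivIset_preimage1.
  - by apply: bigcupT_measurable => n; exact: measurableI.
rewrite (PF (B `&` E)) ?(PF B) //; last exact: measurableI.
rewrite -nneseriesZl //; apply: eq_eseriesr => n _.
case: (F0 n) => [->|[w ->]]; first by rewrite !setI0 measure0 mule0.
(* As [m <= u], a history fixes the state at time [m]. If that state is not [x], both sides
   vanish. *)
have [Bw|nBw] := pselect (B w); last first.
  rewrite (_ : B `&` F _ = set0); last first.
    apply/seteqP; split=> w' // -[Bw']; rewrite FE /= => /(_ m mu) e.
    by apply: nBw; rewrite /B /= -e.
  rewrite (_ : B `&` E `&` F _ = set0) ?measure0 ?mule0 //.
  apply/seteqP; split=> w' // -[[Bw' _]]; rewrite FE /= => /(_ m mu) e.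
  by apply: nBw; rewrite /B /= -e.
have FB : F (hist w) `<=` B.
  by move=> w'; rewrite FE /= => /(_ m mu); rewrite /B /= => ->.
rewrite (setIidr FB) -setIA (setIidr (subset_trans (@subIsetr _ _ _) FB)).
(* Within one history the state at time [u] is the constant [X u w], so the increment event becomes
   an event on [X u.+1] alone, as the Markov property requires. *)
have -> : E `&` F (hist w) = X u.+1 @^-1` [set X u w + j] `&` F (hist w).
  rewrite FE; apply/seteqP; split=> w' /= [Ew' Fw']; split=> //.
    by rewrite Ew' Fw'.
  by rewrite /E /= Ew' Fw'.
(* The Markov property is silent on null histories; there both sides are 0 by monotonicity. *)
have [PF0|PF0] := eqVneq (P (F (hist w))) 0%E.
  rewrite PF0 mule0; apply/eqP; rewrite eq_le measure_ge0 andbT -PF0.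
  by apply: le_measure; rewrite ?inE //; exact: measurableI.
have PFgt0 : (0 < P (F (hist w)))%E by rewrite lt0e PF0 measure_ge0.
have fPF0 : fine (P (F (hist w))) != 0 by rewrite fine_eq0 ?fin_num_measure.
have := HK u (X ^~ w) (X u w + j).
rewrite /= -FE => /(_ PFgt0); rewrite /cond_pr Kq => /(canRL (mulfVK fPF0)) eqq.
rewrite -[LHS]fineK ?fin_num_measure //; last exact: measurableI.
by rewrite eqq EFinM fineK // fin_num_measure.
Qed.

(** The steps 1 and 0 together carry all the mass of [X m = x], so [f] is almost everywhere the
    indicator of a unit step on that event. *)
Lemma source_step_integral (p : R) (m u : nat) (x : int) :
  0 <= p -> p <= 1 -> markov_chain P (source_kernel p) X -> (m <= u)%N ->
  let f w := (X u.+1 w - X u w)%:~R * \1_(X m @^-1` [set x]) w : R in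
  P.-integrable setT (EFin \o f) /\
  (\int[P]_w (f w)%:E = p%:E * P (X m @^-1` [set x]))%E.
Proof.
move=> p0 p1 HX mu f.
set B := X m @^-1` [set x] in f *.
pose E j := [set w | X u.+1 w = X u w + j].
have mB : measurable B := mX m x.
have mE j : measurable (E j) := measurable_step u j.
have PE1 : P (B `&` E 1) = (p%:E * P B)%E.
  apply: (markov_chain_step x HX mu) => // z.
  by rewrite /source_kernel eqxx.
have PE0 : P (B `&` E 0) = ((1 - p)%:E * P B)%E.
  apply: (markov_chain_step x HX mu); rewrite ?subr_ge0 // => z.
  rewrite /source_kernel addr0 eqxx ifF //.
  by rewrite -subr_eq0 opprD addNKr.
rewrite -PE1; apply: ae_eq_indic_integral.
- apply: measurable_funM; first exact: measurable_diff.
  exact: measurable_indic.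
- exact: measurableI.
(* The exceptional set collects the other increments. Its mass is
   [P B - (p * P B + (1 - p) * P B) = 0]. *)
exists (B `\` (B `&` E 1 `|` B `&` E 0)); split.
- by apply: measurableD => //; apply: measurableU; exact: measurableI.
- rewrite measureD //; last 2 first.
  + by apply: measurableU; exact: measurableI.
  + by rewrite ltey_eq fin_num_measure.
  rewrite setIidr; last by move=> w [] [].
  rewrite measureU; [|exact: measurableI|exact: measurableI|].
    rewrite [X in (_ - (X + _))%E]PE1 [X in (_ - (_ + X))%E]PE0.
    rewrite -ge0_muleDl ?lee_fin ?subr_ge0 //.
    by rewrite -EFinD [p + _]addrC subrK mul1e subee // fin_num_measure.
  by apply/seteqP; split=> w // -[[_ E1] [_]]; rewrite /E /= E1 => /addrI.
- move=> w /= nf; have [Bw|nBw] := pselect (B w); last first.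
    exfalso; apply: nf => _.
    by rewrite /f !indicE !memNset ?mulr0 // => -[].
  split=> // -[] [_ Ew]; apply: nf => _; rewrite /f Ew addrAC subrr add0r.
    by rewrite !indicE !mem_set ?mulr1.
  by rewrite mul0r indicE memNset // => -[_]; rewrite /E /= Ew => /addrI.
Qed.

(** Induction on [n]: the displacement telescopes, and each further step adds [p * P (X m = x)].
    Integrability is carried along because additivity of the integral needs it. *)
Lemma source_drift_integral (p : R) (m n : nat) (x : int) :
  0 <= p -> p <= 1 -> markov_chain P (source_kernel p) X ->
  let f w := (X (m + n)%N w - X m w)%:~R * \1_(X m @^-1` [set x]) w : R in
  P.-integrable setT (EFin \o f) /\
  (\int[P]_w (f w)%:E = (n%:R * p)%:E * P (X m @^-1` [set x]))%E.
Proof.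
move=> p0 p1 HX; elim: n => [|n [IHi IHe]] f.
  have f0 : EFin \o f = cst 0%E.
    by apply/funext => w; rewrite /f /= addn0 subrr mul0r.
  split; first by rewrite f0; exact: integrable0.
  by rewrite -/(EFin \o f) f0 integral0 mul0r mul0e.
have [Si Se] := source_step_integral x p0 p1 HX (leq_addr n m).
have fE : EFin \o f = (EFin \o (fun w => (X (m + n)%N w - X m w)%:~R *
    \1_(X m @^-1` [set x]) w : R)) \+ (EFin \o (fun w =>
    (X (m + n).+1 w - X (m + n)%N w)%:~R * \1_(X m @^-1` [set x]) w : R)).
  apply/funext => w; rewrite /f /= -EFinD -mulrDl -rmorphD /= addnS.
  by rewrite [in RHS]addrC addrA subrK.
split; first by rewrite fE; exact: integrableD.
rewrite -/(EFin \o f) fE integralD_EFin //.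
rewrite [X in (X + _)%E]IHe [X in (_ + X)%E]Se.
rewrite -ge0_muleDl ?lee_fin ?mulr_ge0 //.
by rewrite -EFinD -natr1 mulrDl mul1r.
Qed.

End markov_chain_increments.

(** Writing [b = n + a] reduces this to the triangular number [n (n + 1) / 2]. The bound [a <= b]
    makes truncated and real subtraction agree. *)
Lemma sum_subn_nat (R : realType) (a b : nat) :
  (a <= b)%N ->
  \sum_(a <= u < b.+1) ((u - a)%:R : R) =
  (b%:R - a%:R + 1) * (b%:R - a%:R) / 2.
Proof.
move=> /subnK <-; elim: (b - a)%N => [|n IHn].
  by rewrite add0n big_nat1 subnn subrr mulr0 mul0r.
rewrite addSn big_nat_recr /=; last by rewrite ltnW // ltnS leq_addl.
rewrite IHn -addSn addnK !natrD -natr1.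
by field.
Qed.

Theorem lemma2 (d : measure_display) (T : measurableType d) (R : realType)
    (P : probability T R) (dist p : R) (X Xhat : nat -> T -> int)
    (g : nat -> nat) (t : nat) (x : int)
    (dist_gt0 : 0 < dist) (p_ge0 : 0 <= p) (p_le1 : p <= 1)
    (X_source : markov_chain P (source_kernel p) X)
    (g_le : (g t <= t)%N)
    (Xhat_def : forall u : nat, (g t <= u <= t)%N ->
       forall w : T, Xhat u w = X (g t) w)
    (x_pos : (0 < P (X (g t) @^-1` [set x]))%E) :
  (mean_aoii P dist X Xhat g x t =
    \sum_(g t <= u < t.+1)
      dist%:E * cond_expectation P (X (g t) @^-1` [set x])
                  (est_error R X Xhat u))%E /\
  (\sum_(g t <= u < t.+1)
      dist%:E * cond_expectation P (X (g t) @^-1` [set x])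
                  (est_error R X Xhat u) =
    (dist * p *
      (((t%:R - (g t)%:R + 1) * (t%:R - (g t)%:R)) / 2))%:E)%E.
Proof.
have mX := X_source.1.
set B := X (g t) @^-1` [set x] in x_pos *.
have mB : measurable B := mX (g t) x.
have PBfin : P B \is a fin_num by rewrite fin_num_measure.
have PB0 : fine (P B) != 0 by rewrite fine_eq0 // gt_eqF.
(* The error [n] slots after the last reception, restricted to [B] and not yet divided by [P B]. *)
pose f n w : R := (X (g t + n)%N w - X (g t) w)%:~R * \1_B w.
have fP n : P.-integrable setT (EFin \o f n) /\
    (\int[P]_w (f n w)%:E = (n%:R * p)%:E * P B)%E.
  exact: source_drift_integral.
have errE u w : (g t <= u <= t)%N ->
    (X u w - X (g t) w)%:~R * \1_B w = f (u - g t)%N w.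
  by move=> /andP[gu _]; rewrite /f subnKC.
have ce u : (g t <= u <= t)%N ->
    cond_expectation P B (est_error R X Xhat u) =
    ((fine (P B))^-1%:E * \int[P]_w (f (u - g t)%N w)%:E)%E.
  move=> gut; rewrite /cond_expectation unlock; congr (_ * _)%E.
  by apply: eq_integral => w _; rewrite /est_error Xhat_def // errE.
split.
  rewrite /mean_aoii [LHS]/cond_expectation [in LHS]unlock -/B.
  rewrite (eq_integral (fun w => \sum_(g t <= u < t.+1)
      (dist%:E * (EFin \o f (u - g t)%N) w)%E)); last first.
    move=> w _; rewrite /aoii mulr_suml -sumEFin; apply: eq_big_nat => u gut.
    (* The estimates at [t] and at [u] are both [X (g t)] on the window, which contains [t] by
       [g_le]; hence the AoII is the sum of the errors weighted by [dist]. *)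
    by rewrite -EFinM -mulrA Xhat_def ?g_le ?leqnn // errE.
  rewrite integral_sum //; last first.
    by move=> n; apply: integrableZl => //; exact: (fP _).1.
  have intE n : (\int[P]_w (dist%:E * (EFin \o f n) w) =
      dist%:E * \int[P]_w (f n w)%:E)%E.
    by rewrite integralZl //; exact: (fP n).1.
  (* Distributivity in the extended reals is obtained from nonnegative terms; the sign comes from
     the explicit value of each integral. *)
  rewrite ge0_sume_distrr => [|u _]; last first.
    by rewrite intE (fP _).2 !mule_ge0 // lee_fin ?mulr_ge0 // ltW.
  by apply: eq_big_nat => u gut; rewrite intE ce // muleCA.
(* The closed form is expanded back into a sum and compared termwise; the factor [P B] cancels
   against the normalisation. *)
rewrite -sum_subn_nat // mulr_sumr -sumEFin.
apply: eq_big_nat => u gut; rewrite ce // (fP _).2 -[P B]fineK //= -!EFinM.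
by congr EFin; field.
Qed.
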